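(* There is an $O(n^2)$ time algorithm that finds an optimal solution for $1|jrp,s=1,p_j=1,\text{distinct } r_j|F_{\max}+c_\mathcal{Q}$.
   Context: Problem $1|jrp,s=1,p_j=1,\text{distinct } r_j|F_{\max}+c_\mathcal{Q}$: a set $\mathcal{J}$ of $n$ jobs must be processed non-preemptively on a single machine that processes at most one job at a time. Every job has processing time $p_j=1$, and the release dates $r_j\ge0$ of the jobs are pairwise distinct. There is a single resource $R$, required by every job, and nonnegative costs $K_0,K_1$. A solution is a pair $(S,\mathcal{Q})$, where $S$ assigns a start time $S_j$ to each job (completion time $C_j=S_j+1$) and $\mathcal{Q}$ is a finite set of replenishment times $t_1<\dots<t_q$ at which $R$ is replenished. Job $j$ is ready to be started at time $t$ if some replenishment time lies in $[r_j,t]$. The solution is feasible if no two jobs overlap and each job $j$ is ready to be started at $S_j$. The goal is to minimize $\max_j(C_j-r_j)+q(K_0+K_1)$. *)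

(* Defs.v *)
From HB Require Import structures.
From mathcomp Require Export all_boot all_order all_algebra.

Set Implicit Arguments.
Unset Strict Implicit.
Unset Printing Implicit Defensive.

Import Order.TTheory GRing.Theory Num.Theory.
Local Open Scope ring_scope.

(** * The scheduling problem 1|jrp, s=1, p_j=1, distinct r_j|F_max + c_Q *)

(* Jobs are listed in arbitrary order, not by release date.  Times and costs
   live in an arbitrary ordered domain; [int] and the reals are instances. *)
Record instance (R : realDomainType) := Instance {
  njobs : nat;
  release : 'I_njobs -> R;
  cost0 : R;
  cost1 : R
}.

Arguments release {R} i j.

Definition valid_instance (R : realDomainType) (I : instance R) : Prop :=
  [/\ (0 < njobs I)%N,
      forall j, 0 <= release I j,
      injective (release I),
      0 <= cost0 I
    & 0 <= cost1 I].

Record solution (R : realDomainType) (n : nat) := Solution {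
  start : 'I_n -> R;
  repl : seq R
}.

Section Problem.

Variables (R : realDomainType) (I : instance R).
Implicit Types x y : solution R (njobs I).

Definition completion x (j : 'I_(njobs I)) : R := start x j + 1.

Definition ready x (j : 'I_(njobs I)) (t : R) : Prop :=
  exists2 u, u \in repl x & release I j <= u <= t.

(* Strict sortedness makes [repl x] the list t_1 < ... < t_q. *)
Definition feasible x : Prop :=
  [/\ sorted <%R (repl x),
      forall i j, i != j ->
        completion x i <= start x j \/ completion x j <= start x i
    & forall j, ready x j (start x j)].

(* In a feasible solution every flow time is at least 1, so starting the
   iterated maximum at 0 does not change its value. *)
Definition max_flow x : R :=
  \big[Num.max/0]_(j < njobs I) (completion x j - release I j).

Definition objective x : R :=
  max_flow x + (cost0 I + cost1 I) *+ size (repl x).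

Definition optimal x : Prop :=
  feasible x /\ forall y, feasible y -> objective x <= objective y.

End Problem.

Arguments completion {R} I x j.
Arguments ready {R} I x j t.
Arguments feasible {R} I x.
Arguments max_flow {R} I x.
Arguments objective {R} I x.
Arguments optimal {R} I x.

(** * Random access machine programs with unit-cost operations *)

(* The machine has an integer memory, which also provides the addresses
   (indirect addressing through [ILoad] and [RLoad]), and a memory for
   problem data.  The only operations on data are addition, subtraction and
   comparison, and the only constants are 0 and 1: multiplication, division
   and rounding are left out, as is integer multiplication, so the model is
   no stronger than the usual unit-cost (real) RAM.  Programs do not mention [R]. *)

Inductive iexp :=
  | IConst of nat
  | ILoad of iexp
  | IAdd of iexp & iexp
  | ISub of iexp & iexp. (* truncated subtraction *)

Inductive rexp :=
  | RZero
  | ROne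
  | RLoad of iexp
  | RAdd of rexp & rexp
  | RSub of rexp & rexp.

Inductive bexp :=
  | ILe of iexp & iexp
  | RLe of rexp & rexp.

Inductive cmd :=
  | Skip
  | IStore of iexp & iexp (* address, value *)
  | RStore of iexp & rexp (* address, value *)
  | Seq of cmd & cmd
  | If of bexp & cmd & cmd
  | While of bexp & cmd.

Record state (R : realDomainType) := State {
  imem : nat -> nat;
  rmem : nat -> R
}.

Definition upd (T : Type) (m : nat -> T) (a : nat) (v : T) : nat -> T :=
  fun b => if b == a then v else m b.

(* Evaluating an expression costs one step per node. *)
Fixpoint icost (e : iexp) : nat :=
  match e with
  | IConst _ => 1
  | ILoad a => (icost a).+1
  | IAdd e1 e2 | ISub e1 e2 => (icost e1 + icost e2).+1
  end.

Fixpoint rcost (e : rexp) : nat :=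
  match e with
  | RZero | ROne => 1
  | RLoad a => (icost a).+1
  | RAdd e1 e2 | RSub e1 e2 => (rcost e1 + rcost e2).+1
  end.

Definition bcost (b : bexp) : nat :=
  match b with
  | ILe e1 e2 => (icost e1 + icost e2).+1
  | RLe e1 e2 => (rcost e1 + rcost e2).+1
  end.

Section Semantics.

Variable R : realDomainType.
Implicit Types s : state R.

Fixpoint ieval s (e : iexp) : nat :=
  match e with
  | IConst k => k
  | ILoad a => imem s (ieval s a)
  | IAdd e1 e2 => (ieval s e1 + ieval s e2)%N
  | ISub e1 e2 => (ieval s e1 - ieval s e2)%N
  end.

Fixpoint reval s (e : rexp) : R :=
  match e with
  | RZero => 0
  | ROne => 1
  | RLoad a => rmem s (ieval s a)
  | RAdd e1 e2 => reval s e1 + reval s e2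
  | RSub e1 e2 => reval s e1 - reval s e2
  end.

Definition beval s (b : bexp) : bool :=
  match b with
  | ILe e1 e2 => (ieval s e1 <= ieval s e2)%N
  | RLe e1 e2 => reval s e1 <= reval s e2
  end.

Definition istore s (a v : nat) : state R := State (upd (imem s) a v) (rmem s).
Definition rstore s (a : nat) (v : R) : state R :=
  State (imem s) (upd (rmem s) a v).

(* [exec P s t s']: started in s, P halts in s' after exactly t steps. *)
Inductive exec : cmd -> state R -> nat -> state R -> Prop :=
  | ExecSkip s : exec Skip s 1 s
  | ExecIStore s a e :
      exec (IStore a e) s (icost a + icost e).+1
           (istore s (ieval s a) (ieval s e))
  | ExecRStore s a e :
      exec (RStore a e) s (icost a + rcost e).+1
           (rstore s (ieval s a) (reval s e))
  | ExecSeq s1 s2 s3 P1 P2 t1 t2 :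
      exec P1 s1 t1 s2 -> exec P2 s2 t2 s3 ->
      exec (Seq P1 P2) s1 (t1 + t2) s3
  | ExecIf s1 s2 b P1 P2 t :
      exec (if beval s1 b then P1 else P2) s1 t s2 ->
      exec (If b P1 P2) s1 (bcost b + t) s2
  | ExecWhileEnd s b P :
      ~~ beval s b -> exec (While b P) s (bcost b) s
  | ExecWhileStep s1 s2 s3 b P t1 t2 :
      beval s1 b -> exec P s1 t1 s2 -> exec (While b P) s2 t2 s3 ->
      exec (While b P) s1 (bcost b + t1 + t2) s3.

Lemma exec_det P s t1 s1 t2 s2 :
  exec P s t1 s1 -> exec P s t2 s2 -> t1 = t2 /\ s1 = s2.
Proof.
move=> E; elim: E t2 s2 => {P s t1 s1}.
- by move=> s t s' E; inversion E.
- by move=> s a e t s' E; inversion E.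
- by move=> s a e t s' E; inversion E.
- move=> s1 s2 s3 P1 P2 t1 t2 _ IH1 _ IH2 t s E.
  inversion E as [| | |? u ? ? ? ? ? E1 E2| | |]; subst.
  have [? ?] := IH1 _ _ E1; subst.
  by have [? ?] := IH2 _ _ E2; subst.
- move=> s1 s2 b P1 P2 t _ IH t' s E.
  inversion E as [| | | |? ? ? ? ? ? E1| |]; subst.
  by have [? ?] := IH _ _ E1; subst.
- move=> s b P nb t s' E.
  inversion E as [| | | | | |? u ? ? ? ? ? hb]; first by [].
  by rewrite hb in nb.
- move=> s1 s2 s3 b P t1 t2 hb _ IH1 _ IH2 t s E.
  inversion E as [| | | | |? ? ? nb|? u ? ? ? ? ? _ E1 E2]; subst.
    by rewrite hb in nb.
  have [? ?] := IH1 _ _ E1; subst.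
  by have [? ?] := IH2 _ _ E2; subst.
Qed.

(* Input: integer cell 0 holds n; data cells 0..n-1 hold the release dates,
   cells n and n+1 hold K_0 and K_1; every other cell is 0. *)
Definition input (I : instance R) : state R :=
  State (fun a => if a == 0 then njobs I else 0)%N
        (fun a => if insub a is Some j then release I j
                  else if a == njobs I then cost0 I
                  else if a == (njobs I).+1 then cost1 I
                  else 0).

(* Output: data cells 0..n-1 hold the start times; integer cell 0 holds q and
   data cells n..n+q-1 hold t_1, ..., t_q. *)
Definition output (n : nat) s : solution R n :=
  Solution (fun j : 'I_n => rmem s j)
           (mkseq (fun i => rmem s (n + i)%N) (imem s 0)).

End Semantics.

(* Main.v *)
Require Import Defs.
From mathcomp Require Import all_boot all_order all_algebra.
From mathcomp Require Import zify lra.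

Set Implicit Arguments.
Unset Strict Implicit.
Unset Printing Implicit Defensive.

Import Order.TTheory GRing.Theory Num.Theory.

(* Sort the jobs so that r_0 < ... < r_{n-1} and put
   B_i = max_{j >= i} (j - i + 1 - r_j).  If the jobs i, i+1, ... all start at
   time u or later, then for every j >= i one of the jobs i..j completes no
   earlier than u + (j - i + 1), so that the maximum flow time is at least
   u + B_i.  Hence a solution with q replenishments and maximum flow time F cuts
   0..n-1 into at most q consecutive batches [i, e) with r_{e-1} + B_i <= F.
   Conversely, replenishing every batch at r_{e-1} and serving the jobs first-in
   first-out turns such a cut into a solution with maximum flow time at most F.
   It remains to minimise this bottleneck for every number q of batches:
     D_q(e) = min_{i < e} max (D_{q-1}(i), r_{e-1} + B_i).
   The first argument of the maximum is nondecreasing and the second one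
   decreasing in i, and their crossing point moves monotonically with e, so that
   a layer takes O(n) steps.  For the best F the batches are recovered greedily
   from the right. *)

(** * Covers of the sorted jobs by batches of bounded cost *)

Section Batching.

Local Open Scope ring_scope.

Variables (R : realDomainType) (n : nat) (r B : nat -> R).

Hypothesis r_incr : forall i j, (i < j < n)%N -> r i < r j.
Hypothesis B_step : forall i, (i.+1 < n)%N -> 1 + B i.+1 <= B i.

(* As [e = 0] is allowed for every [q], [q] is an upper bound on the number of
   batches that [0, e) is cut into, each of them of cost at most [F]. *)
Fixpoint cov (F : R) (q e : nat) : Prop :=
  e = 0%N \/
  if q is q'.+1 then
    exists i, [/\ (i < e)%N, cov F q' i & r e.-1 + B i <= F]
  else False.

Lemma r_mono i j : (i <= j < n)%N -> r i <= r j.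
Proof.
case/andP=> ij jn; case: (ltngtP i j) ij => // [ij _|-> //].
by apply/ltW/r_incr; rewrite ij.
Qed.

Lemma B_anti i j : (i <= j < n)%N -> B j <= B i.
Proof.
case/andP; elim: j => [|j IH] ij jn; first by have -> : i = 0%N by lia.
case: (ltngtP i j.+1) ij => // [ij _|-> //].
have h := B_step jn; have h' := IH ij (ltnW jn); lra.
Qed.

Lemma cov0 F q : cov F q 0.
Proof. by case: q => *; left. Qed.

Lemma covS F q e : cov F q e -> cov F q.+1 e.
Proof.
elim: q e => [|q IH] e; first by case=> // ->; left.
case=> [->|[i [ie /IH ci h]]]; first by left.
by right; exists i.
Qed.

Lemma cov_leq F q q' e : (q <= q')%N -> cov F q e -> cov F q' e.
Proof.
move/subnKC <-; elim: (q' - q)%N => [|d IH] c; rewrite ?addn0 // addnS.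
exact/covS/IH.
Qed.

(** Truncating the last batch moves its replenishment to an earlier release date, so its cost does
    not grow. *)
Lemma cov_prefix F q e e' : (e' <= e <= n)%N -> cov F q e -> cov F q e'.
Proof.
elim: q e e' => [|q IH] e e' /andP[le le_n] /=.
  by case=> // e0; left; lia.
case=> [e0|[i [ie ci h]]]; first by left; lia.
case: (posnP e') => [->|e'0]; first by left.
case: (leqP e' i) => e'i.
  by apply: (@covS F q); apply: IH ci; lia.
right; exists i; split=> //; apply: le_trans h; rewrite lerD2r.
by apply: r_mono; lia.
Qed.

(** Batches are nonempty, so [e] jobs need at most [e] of them. This caps the numbers of
    replenishments to be examined. *)
Lemma cov_size F q e : cov F q e -> cov F e e.
Proof.
elim: q e => [|q IH] e; first by case=> // ->; left.
case=> [->|[i [ie /IH ci h]]]; first by left.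
case: e ie h => // e ie h; right; exists i; split=> //.
by apply: cov_leq ci; lia.
Qed.

(** In the cover truncated after job [i], the last batch is replenished at [r i] and opens at some
    [j <= i], where [B j >= B i]. *)
Lemma cov_le F q i e : (i < e)%N -> (e <= n)%N -> cov F q e -> r i + B i <= F.
Proof.
move=> ie en c; have : cov F q i.+1 by apply: cov_prefix c; lia.
case: q {c} => [|q]; first by case.
case=> // [[j [ji _ h]]]; apply: le_trans h; rewrite lerD2l.
by apply: B_anti; lia.
Qed.

(* The segment chosen last is the maximal one compatible with a replenishment
   time that serves job [e.-1]; no earlier job can then be served by it. *)
Lemma cov_of_witnesses F (T : seq R) e : (e <= n)%N ->
  (forall k, (k < e)%N -> exists2 u, u \in T & (r k <= u) && (u + B k <= F)) ->
  cov F (size T) e.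
Proof.
have [m] := ubnP (size T); elim: m => // m IH in T e *.
rewrite ltnS => sT en W; case: (posnP e) => [->|e0]; first exact: cov0.
have /W[u uT /andP[ru uF]] : (e.-1 < e)%N by rewrite prednK.
have hex : exists i, u + B i <= F by exists e.-1.
have [i iF imin] := ex_minnP hex.
have ie : (i <= e.-1)%N by apply: imin.
have sz : (size (filter (predC1 u) T) < size T)%N.
  rewrite size_filter ltn_neqAle count_size andbT -all_count.
  by apply/allPn; exists u; rewrite //= eqxx.
have c : cov F (size (filter (predC1 u) T)) i.
  apply: IH; [by apply: leq_trans sz _|lia|].
  move=> k ki; have /W[v vT hv] : (k < e)%N by lia.
  exists v => //; rewrite mem_filter /= vT andbT.
  by apply/eqP=> vu; move: hv; rewrite vu => /andP[_ /imin]; lia.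
case: (size T) sz => // s; rewrite ltnS => sz; right; exists i; split; [lia| |].
  exact: cov_leq c.
by apply: le_trans iF; rewrite lerD2r.
Qed.

Lemma cov1 F e : (0 < e)%N -> cov F 1 e <-> r e.-1 + B 0 <= F.
Proof.
move=> e0; split; last by move=> h; right; exists 0%N; split=> //; left.
by case=> [e1|[i [_ [->|//] ->//]]]; rewrite e1 in e0.
Qed.

(* [p] is the crossing point of the nondecreasing [D i] and the decreasing
   [r e + B i], where the minimum over [i] of their maximum is attained. *)
Lemma cov_layer q (D : nat -> R) e p :
  (forall k, (k <= n)%N -> forall F, 0 <= F -> D k <= F <-> cov F q k) ->
  (p <= e < n)%N -> D p <= r e + B p ->
  (forall i, (p < i <= e)%N -> r e + B i < D i) ->
  forall F, 0 <= F ->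
    Num.min (r e + B p) (D p.+1) <= F <-> cov F q.+1 e.+1.
Proof.
move=> HD pe hp hi F F0; rewrite ge_min; split.
  case/orP=> h.
    right; exists p; split=> //; first lia.
    by apply/HD => //; [lia|exact: le_trans hp h].
  case: (ltngtP p e) pe => // [pe en|pe en].
    right; exists p.+1; split; [lia|by apply/HD => //; lia|].
    by apply: le_trans h; apply/ltW/hi; lia.
  (* For [p = e] there is no candidate beyond [p]: [D e.+1] is the value of the same prefix with one
     batch fewer, and a cover by [q] batches also counts for [q.+1]. *)
  by apply/(@covS F q)/HD => //; rewrite -?pe //; lia.
case=> // [[i [ie ci h]]].
case: (leqP i p) => ip.
  apply/orP; left; apply: le_trans h; rewrite lerD2l; apply: B_anti; lia.
apply/orP; right; apply/HD => //; first lia.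
by apply: cov_prefix ci; lia.
Qed.

End Batching.

Arguments cov : simpl never.

(** * Lower bound: every feasible solution induces a cover *)

Section LowerBound.

Local Open Scope ring_scope.

Variables (R : realDomainType) (I : instance R).
Let n := njobs I.
Implicit Type y : solution R n.

(** Unit jobs that do not overlap need [m.+1] units of time after [u]. The induction removes the job
    with the latest start, which must follow the late job found among the others. *)
Lemma late_completion y (u : R) (m : nat) (A : {set 'I_n}) :
  feasible I y -> (forall i, i \in A -> u <= start y i) -> #|A| = m.+1 ->
  exists2 i, i \in A & u + m.+1%:R <= completion I y i.
Proof.
case=> _ disj _; elim: m A => [|m IH] A hA cA.
  have /card_gt0P[i iA] : (0 < #|A|)%N by rewrite cA.
  by exists i => //; rewrite /completion; have := hA _ iA; lra.
have /card_gt0P[i0 i0A] : (0 < #|A|)%N by rewrite cA.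
case: (@Order.TotalTheory.arg_maxP _ R _ i0 (fun i => i \in A) (start y) i0A) => i /= iA imax.
have [||j /setD1P[ji jA] hj] := IH (A :\ i).
- by move=> k /setD1P[_ /hA].
- by have := cardsD1 i A; rewrite iA cA; lia.
exists i => //.
have {imax} := imax _ jA; rewrite /Order.ge /= => imax.
case: (disj _ _ ji) hj; rewrite /completion -![_.+1%:R]natr1 => ? ?; lra.
Qed.

Variables (r B : nat -> R) (rk : 'I_n -> 'I_n).
Hypothesis rk_inj : injective rk.
Hypothesis r_rk : forall j, r (rk j) = release I j.
Hypothesis r_incr : forall i j, (i < j < n)%N -> r i < r j.
Hypothesis B_witness : forall i, (i < n)%N ->
  exists2 j, (i <= j < n)%N & B i = (j - i).+1%:R - r j.

Lemma rank_interval i j : (i <= j < n)%N ->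
  exists2 A : {set 'I_n}, #|A| = (j - i).+1 & forall x, x \in A -> (i <= rk x <= j)%N.
Proof.
move=> /andP[ij jn]; have [g _ gK] := injF_bij rk_inj.
pose f (x : 'I_(j - i).+1) := g (insubd (Ordinal jn) (i + x)%N).
have fE x : rk (f x) = (i + x)%N :> nat.
  by rewrite /f gK val_insubd; have := ltn_ord x; case: ifP; lia.
exists [set f x | x : 'I_(j - i).+1].
  rewrite card_imset ?card_ord // => x y /(congr1 (fun z => val (rk z))) /=.
  by rewrite !fE => h; apply/val_inj => /=; lia.
by move=> _ /imsetP[x _ ->]; rewrite fE; have := ltn_ord x; lia.
Qed.

Lemma flow_le_max_flow y j : completion I y j - release I j <= max_flow I y.
Proof. by rewrite /max_flow (bigD1 j) //= le_max lexx. Qed.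

Lemma max_flow_ge0 y : 0 <= max_flow I y.
Proof. exact: bigmax_ge_id. Qed.

Lemma seq_least (T : seq R) (P : pred R) : has P T ->
  exists2 u, u \in T & P u /\ forall v, v \in T -> P v -> u <= v.
Proof.
elim: T => //= a T IH.
case hT: (has P T); rewrite ?orbT ?orbF => ha.
  have [u uT [Pu umin]] := IH hT.
  case: (boolP (P a && (a <= u))) => [/andP[Pa au]|na].
    exists a; rewrite ?mem_head //; split=> // v; rewrite inE => /orP[/eqP-> //|vT Pv].
    exact: le_trans au (umin _ vT Pv).
  exists u; rewrite ?inE ?uT ?orbT //; split=> // v.
  rewrite inE => /orP[/eqP-> Pa|]; last exact: umin.
  by move: na; rewrite Pa /= -ltNge => /ltW.
exists a; rewrite ?mem_head //; split=> // v; rewrite inE => /orP[/eqP-> //|vT Pv].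
by move/hasPn: hT => /(_ v vT); rewrite Pv.
Qed.

(** The witness for [k] is the first replenishment [u] not before [r k]. All jobs of rank at least
    [k] start at [u] or later; if [j] attains [B k], one of the jobs [k..j] completes at
    [u + (j - k + 1)] or later and is released by [r j], so its flow time is at least [u + B k]. *)
Lemma feasible_cov y : feasible I y -> cov r B (max_flow I y) (size (repl y)) n.
Proof.
move=> fy; have [_ _ rdy] := fy; apply: cov_of_witnesses => // k kn.
have rsurj j : (j < n)%N -> exists x, rk x = j :> nat.
  move=> jn; have [g _ gK] := injF_bij rk_inj.
  by exists (g (Ordinal jn)); rewrite gK.
have hsT : has (fun u => r k <= u) (repl y).
  have [x xk] := rsurj _ kn; have [u uT /andP[ru _]] := rdy x.
  by apply/hasP; exists u; rewrite // -xk r_rk.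
have [u uT [ru umin]] := seq_least hsT; exists u => //; rewrite ru /=.
have [j /andP[kj jn] ->] := B_witness kn.
have rm i i' : (i <= i' < n)%N -> r i <= r i' by exact: r_mono.
have [|A cA hA] := @rank_interval k j; first by rewrite kj.
have [||x /hA /andP[_ xj] hx] := @late_completion y u (j - k) A fy => //.
  move=> x /hA /andP[kx _]; have [v vT /andP[rv vx]] := rdy x.
  apply: le_trans vx; apply: umin => //; apply: le_trans rv.
  by rewrite -r_rk; apply: rm; rewrite kx /=.
have hf := flow_le_max_flow y x.
have : r (rk x) <= r j by apply: rm; rewrite xj.
by rewrite r_rk; lra.
Qed.

End LowerBound.

(** * A program logic with step budgets *)

Fixpoint loop_free_time (P : cmd) : nat :=
  match P with
  | Skip => 1
  | IStore a e => (icost a + icost e).+1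
  | RStore a e => (icost a + rcost e).+1
  | Seq P1 P2 => loop_free_time P1 + loop_free_time P2
  | If b P1 P2 => bcost b + maxn (loop_free_time P1) (loop_free_time P2)
  | While _ _ => 0
  end.

Definition incr (i : nat) : cmd :=
  IStore (IConst i) (IAdd (ILoad (IConst i)) (IConst 1)).

(* [for i < e do P], with [i] kept in integer cell [i] and [e] re-evaluated at
   every test. *)
Definition For (i : nat) (e : iexp) (P : cmd) : cmd :=
  Seq (IStore (IConst i) (IConst 0))
      (While (ILe (IAdd (ILoad (IConst i)) (IConst 1)) e) (Seq P (incr i))).

Section Hoare.

Variable R : realDomainType.
Implicit Types (s : state R) (Q : state R -> Prop).

(** Total correctness within a budget of [T] steps; by [exec_det] the execution is unique. *)
Definition runs P s (T : nat) Q : Prop :=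
  exists t s', [/\ exec P s t s', t <= T & Q s'].

(** Loops get [False], which makes the default time 0 of [loop_free_time] harmless; they are handled
    by [runs_while] and [runs_for]. *)
Fixpoint wp (P : cmd) s Q : Prop :=
  match P with
  | Skip => Q s
  | IStore a e => Q (istore s (ieval s a) (ieval s e))
  | RStore a e => Q (rstore s (ieval s a) (reval s e))
  | Seq P1 P2 => wp P1 s (fun s' => wp P2 s' Q)
  | If b P1 P2 => if beval s b then wp P1 s Q else wp P2 s Q
  | While _ _ => False
  end.

Lemma runs_leq P s T T' Q : T <= T' -> runs P s T Q -> runs P s T' Q.
Proof. by move=> le [t [s' [E tT Qs]]]; exists t, s'; split=> //; apply: leq_trans le. Qed.

Lemma runs_impl P s T Q Q' :
  (forall s', Q s' -> Q' s') -> runs P s T Q -> runs P s T Q'.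
Proof. by move=> QQ' [t [s' [E tT /QQ' Qs]]]; exists t, s'. Qed.

Lemma runs_seq P1 P2 s T1 T2 Q1 Q :
  runs P1 s T1 Q1 -> (forall s', Q1 s' -> runs P2 s' T2 Q) ->
  runs (Seq P1 P2) s (T1 + T2) Q.
Proof.
case=> t1 [s1 [E1 le1 /[swap]/[apply]]] [t2 [s2 [E2 le2 Qs]]].
by exists (t1 + t2), s2; split=> //; [exact: ExecSeq E1 E2|exact: leq_add].
Qed.

Lemma runs_wp P s Q : wp P s Q -> runs P s (loop_free_time P) Q.
Proof.
elim: P s Q => [|a e|a e|P1 IH1 P2 IH2|b P1 IH1 P2 IH2|//] s Q /=.
- by exists 1, s; split=> //; exact: ExecSkip.
- by eexists; eexists; split; [exact: ExecIStore| |].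
- by eexists; eexists; split; [exact: ExecRStore| |].
- by move=> h; apply: runs_seq (IH1 _ _ h) _ => s'; exact: IH2.
- case hb: (beval s b) => h; [have := IH1 _ _ h|have := IH2 _ _ h];
    case=> t [s' [E le Qs]]; exists (bcost b + t), s'; split=> //.
  + by apply: ExecIf; rewrite hb.
  + by rewrite leq_add2l (leq_trans le) ?leq_maxl.
  + by apply: ExecIf; rewrite hb.
  + by rewrite leq_add2l (leq_trans le) ?leq_maxr.
Qed.

(** The variant [mu] bounds the number of iterations; the last summand pays for the failing test. *)
Lemma runs_while (Inv : state R -> Prop) (mu : state R -> nat) b P T s :
  (forall s, Inv s -> beval s b ->
     runs P s T (fun s' => Inv s' /\ mu s' < mu s)) ->
  Inv s ->
  runs (While b P) s ((bcost b + T) * mu s + bcost b)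
       (fun s' => Inv s' /\ ~~ beval s' b).
Proof.
move=> body; have [m] := ubnP (mu s); elim: m s => // m IH s; rewrite ltnS => sm Is.
case hb: (beval s b); last first.
  exists (bcost b), s; split; [by apply: ExecWhileEnd; rewrite hb|lia|by rewrite hb].
have [t1 [s1 [E1 le1 [Is1 lt1]]]] := body _ Is hb.
have [t2 [s2 [E2 le2 Qs]]] := IH _ (leq_trans lt1 sm) Is1.
exists (bcost b + t1 + t2), s2; split=> //; first exact: ExecWhileStep E1 E2.
case: (mu s) lt1 => // k; rewrite ltnS => lt1.
have : (bcost b + T) * mu s1 <= (bcost b + T) * k by rewrite leq_mul2l lt1 orbT.
rewrite mulnS; lia.
Qed.

Lemma runs_for (Inv : nat -> state R -> Prop) i e m P T s :
  (forall k s, Inv k s -> imem s i = k /\ ieval s e = m) ->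
  (forall k s, k < m -> Inv k s -> runs (Seq P (incr i)) s T (Inv k.+1)) ->
  Inv 0 (istore s i 0) ->
  runs (For i e P) s ((T + icost e + 5) * m + icost e + 10) (Inv m).
Proof.
move=> Ie body I0.
(* Setting the counter costs 3, each test [icost e + 5]; [T] already includes the increment. *)
have -> : (T + icost e + 5) * m + icost e + 10 =
          3 + (((icost e + 5) + T) * m + (icost e + 7)) by lia.
apply: (@runs_seq _ _ _ _ _ (fun s' => s' = istore s i 0)).
  exact: (@runs_wp (IStore _ _)).
move=> _ ->; set s0 := istore s i 0.
pose I s := exists2 k, k <= m & Inv k s.
have I00 : I s0 by exists 0.
have [|t [s' [E le [[k km Ik] nb]]]] := @runs_while I (fun s => m - imem s i)
  (ILe (IAdd (ILoad (IConst i)) (IConst 1)) e) (Seq P (incr i)) T s0 _ I00.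
  move=> s1 [k km Ik] /=; have [-> ->] := Ie _ _ Ik => hk.
  apply: runs_impl (body k s1 _ Ik); last by lia.
  move=> s2 Ik2; have [-> _] := Ie _ _ Ik2; split; last lia.
  by exists k.+1 => //; lia.
exists t, s'; split; [exact: E| |].
  apply: leq_trans le _; rewrite /= /upd eqxx subn0; lia.
move: nb => /=; have [-> ->] := Ie _ _ Ik => nb.
by have <- : k = m by lia.
Qed.

End Hoare.

(** * The program and its memory layout *)

Definition iset (k : nat) (e : iexp) : cmd := IStore (IConst k) e.
Definition ivar (k : nat) : iexp := ILoad (IConst k).
Definition nvar : iexp := ivar 0.

(* Integer cells 1 to 5 are variables, and cell 10 + j holds the rank of job j.
   In the data memory the input is followed by a few scalars, starting at
   address n + 2, and by the arrays of sorted release dates, of the B_i, of D_q,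
   of start times and of replenishment times; the last one is filled from its
   end, where the latest replenishment stands. *)
Definition adr_scalar (k : nat) : iexp := IAdd nvar (IConst k).
Definition adr_rel (x : iexp) : iexp := IAdd (IAdd nvar (IConst 10)) x.
Definition adr_tail (x : iexp) : iexp :=
  IAdd (IAdd (IAdd nvar nvar) (IConst 10)) x.
Definition adr_dp (x : iexp) : iexp :=
  IAdd (IAdd (IAdd (IAdd nvar nvar) nvar) (IConst 11)) x.
Definition adr_start (x : iexp) : iexp :=
  IAdd (IAdd (IAdd (IAdd (IAdd nvar nvar) nvar) nvar) (IConst 12)) x.
Definition adr_repl (x : iexp) : iexp :=
  IAdd (IAdd (IAdd (IAdd (IAdd (IAdd nvar nvar) nvar) nvar) nvar) (IConst 20)) x.

(** Sorting by counting: the rank of a job is the number of smaller release dates, and distinct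
    dates make the ranks a permutation. *)
Definition sort_cmd : cmd :=
  For 1 nvar
    (Seq (iset 3 (IConst 0))
    (Seq (For 2 nvar
           (If (RLe (RLoad (ivar 1)) (RLoad (ivar 2))) Skip (incr 3)))
    (Seq (IStore (IAdd (IConst 10) (ivar 1)) (ivar 3))
         (RStore (adr_rel (ivar 3)) (RLoad (ivar 1)))))).

(* B_n = - r_{n-1} is a sentinel: it makes B_{n-1} = 1 - r_{n-1} an instance of
   B_k = max (1 - r_k, 1 + B_{k+1}). *)
Definition tail_cmd : cmd :=
  Seq (RStore (adr_tail nvar)
              (RSub RZero (RLoad (adr_rel (ISub nvar (IConst 1))))))
  (For 1 nvar
    (Seq (iset 2 (ISub nvar (IAdd (ivar 1) (IConst 1))))
    (If (RLe (RSub ROne (RLoad (adr_rel (ivar 2))))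
             (RAdd ROne (RLoad (adr_tail (IAdd (ivar 2) (IConst 1))))))
        (RStore (adr_tail (ivar 2))
                (RAdd ROne (RLoad (adr_tail (IAdd (ivar 2) (IConst 1))))))
        (RStore (adr_tail (ivar 2))
                (RSub ROne (RLoad (adr_rel (ivar 2)))))))).

(* Scalars: 2 = K_0 + K_1, 3 = cost of the current number of replenishments,
   4 = best objective value, 5 = its flow time, 6 = current replenishment. *)
Definition dp_init_cmd : cmd :=
  Seq (For 1 nvar
         (RStore (adr_dp (IAdd (ivar 1) (IConst 1)))
                 (RAdd (RLoad (adr_rel (ivar 1))) (RLoad (adr_tail (IConst 0))))))
  (Seq (RStore (adr_dp (IConst 0)) RZero)
  (Seq (RStore (adr_scalar 2)
               (RAdd (RLoad (adr_scalar 0)) (RLoad (adr_scalar 1))))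
  (Seq (RStore (adr_scalar 3) (RLoad (adr_scalar 2)))
  (Seq (RStore (adr_scalar 5) (RLoad (adr_dp nvar)))
       (RStore (adr_scalar 4)
               (RAdd (RLoad (adr_dp nvar)) (RLoad (adr_scalar 3)))))))).

Definition dp_bound : rexp :=
  RAdd (RLoad (adr_rel (ISub (ivar 3) (IConst 1)))) (RLoad (adr_tail (ivar 4))).

(* Cells 3 and 4 hold e and the crossing point p; as e decreases and D_q(e) only
   depends on D_{q-1}(i) with i <= e, the new layer overwrites the old one. *)
Definition dp_step_cmd : cmd :=
  If (ILe (ivar 3) (ivar 4)) (iset 4 (ISub (ivar 4) (IConst 1)))
  (If (RLe (RLoad (adr_dp (ivar 4))) dp_bound)
      (Seq (If (RLe dp_bound (RLoad (adr_dp (IAdd (ivar 4) (IConst 1)))))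
               (RStore (adr_dp (ivar 3)) dp_bound)
               (RStore (adr_dp (ivar 3))
                       (RLoad (adr_dp (IAdd (ivar 4) (IConst 1))))))
           (iset 3 (ISub (ivar 3) (IConst 1))))
      (iset 4 (ISub (ivar 4) (IConst 1)))).

Definition dp_layer_cmd : cmd :=
  Seq (Seq (iset 3 nvar) (iset 4 (ISub nvar (IConst 1))))
      (While (ILe (IConst 1) (ivar 3)) dp_step_cmd).

Definition dp_best_cmd : cmd :=
  Seq (RStore (adr_scalar 3) (RAdd (RLoad (adr_scalar 3)) (RLoad (adr_scalar 2))))
      (If (RLe (RLoad (adr_scalar 4))
               (RAdd (RLoad (adr_dp nvar)) (RLoad (adr_scalar 3))))
          Skip
          (Seq (RStore (adr_scalar 5) (RLoad (adr_dp nvar)))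
               (RStore (adr_scalar 4)
                       (RAdd (RLoad (adr_dp nvar)) (RLoad (adr_scalar 3)))))).

Definition dp_cmd : cmd := For 1 nvar (Seq dp_layer_cmd dp_best_cmd).

(* Until [start_cmd] runs, the start time array holds the replenishment time
   assigned to each job. *)
Definition greedy_cmd : cmd :=
  Seq (Seq (RStore (adr_scalar 6) (RLoad (adr_rel (ISub nvar (IConst 1)))))
      (Seq (iset 5 (IConst 1))
      (Seq (RStore (adr_repl (ISub nvar (ivar 5))) (RLoad (adr_scalar 6)))
           (RStore (adr_start (ISub nvar (IConst 1))) (RLoad (adr_scalar 6))))))
  (For 1 (ISub nvar (IConst 1))
    (Seq (iset 2 (ISub nvar (IAdd (ivar 1) (IConst 2))))
    (Seq (If (RLe (RAdd (RLoad (adr_scalar 6)) (RLoad (adr_tail (ivar 2))))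
                  (RLoad (adr_scalar 5)))
             Skip
             (Seq (RStore (adr_scalar 6) (RLoad (adr_rel (ivar 2))))
             (Seq (incr 5)
                  (RStore (adr_repl (ISub nvar (ivar 5))) (RLoad (adr_scalar 6))))))
         (RStore (adr_start (ivar 2)) (RLoad (adr_scalar 6)))))).

(** First-in first-out: each job starts at the maximum of its replenishment time and the completion
    time of its predecessor. *)
Definition start_cmd : cmd :=
  For 1 (ISub nvar (IConst 1))
    (If (RLe (RLoad (adr_start (IAdd (ivar 1) (IConst 1))))
             (RAdd (RLoad (adr_start (ivar 1))) ROne))
        (RStore (adr_start (IAdd (ivar 1) (IConst 1)))
                (RAdd (RLoad (adr_start (ivar 1))) ROne))
        Skip).

(** Cell 0 is overwritten last because all addresses are computed from the [n] it holds. The copies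
    land below address [2n], clear of the arrays they are read from. *)
Definition output_cmd : cmd :=
  Seq (For 1 nvar
         (RStore (ivar 1)
                 (RLoad (adr_start (ILoad (IAdd (IConst 10) (ivar 1)))))))
  (Seq (For 1 (ivar 5)
          (RStore (IAdd nvar (ivar 1))
                  (RLoad (adr_repl (IAdd (ISub nvar (ivar 5)) (ivar 1))))))
       (iset 0 (ivar 5))).

Ltac mem_simp :=
  rewrite /= /upd /=;
  repeat match goal with
  | |- context [if ?a == ?b then _ else _] =>
    let E := fresh "E" in
    first [ have E : (a == b) = false by lia | have E : (a == b) = true by lia ];
    rewrite E; clear E
  end.

(** * Ranks of jobs by release date *)

Section Rank.

Variables (R : realDomainType) (n : nat) (rel : nat -> R).
Hypothesis rel_inj : forall i j, i < n -> j < n -> rel i = rel j -> i = j.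

Definition rank (j : nat) : nat := count (fun i => (rel i < rel j)%R) (iota 0 n).

(** Everything counted for [i] is counted for [j], and [i] itself is counted only for [j]. *)
Lemma rank_lt i j : i < n -> (rel i < rel j)%R -> rank i < rank j.
Proof.
move=> lin lij; rewrite /rank.
have e : perm_eq (iota 0 n) (i :: rem i (iota 0 n)) by apply: perm_to_rem; rewrite mem_iota; lia.
rewrite !(permP e) /= ltxx lij add0n add1n ltnS; apply: sub_count => k /= h.
exact: lt_trans h lij.
Qed.

Lemma rank_inj i j : i < n -> j < n -> rank i = rank j -> i = j.
Proof.
move=> lin ljn e; apply: rel_inj => //.
by case: (ltgtP (rel i) (rel j)) => // h; [have := rank_lt lin h|have := rank_lt ljn h]; lia.
Qed.

Lemma rank_lt_n j : j < n -> rank j < n.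
Proof.
move=> jn; rewrite -[X in _ < X](size_iota 0 n) ltn_neqAle count_size andbT -all_count.
by apply/allPn; exists j; rewrite ?mem_iota ?ltxx.
Qed.

End Rank.

(** * Specifications of the phases: sorting and the values [B i] *)

Section Phases.

Variables (R : realDomainType) (n : nat).
Hypothesis n_gt0 : 0 < n.
Implicit Type s : state R.

Lemma sort_spec (rel : nat -> R) s0 :
  (forall i j, i < n -> j < n -> rel i = rel j -> i = j) ->
  imem s0 0 = n -> (forall a, a < n + 2 -> rmem s0 a = rel a) ->
  runs sort_cmd s0 (200 * n ^ 2) (fun s =>
   [/\ imem s 0 = n, forall a, a < n + 2 -> rmem s a = rel a
    & forall j, j < n -> imem s (10 + j) = rank n rel j /\
                         rmem s (n + 10 + rank n rel j) = rel j]).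
Proof.
move=> rel_inj i0 hrel.
pose Inv j s := [/\ imem s 0 = n, imem s 1 = j, forall a, a < n + 2 -> rmem s a = rel a
   & forall k, k < j -> k < n ->
     imem s (10 + k) = rank n rel k /\ rmem s (n + 10 + rank n rel k) = rel k].
have h0 : Inv 0 (istore s0 1 0) by split.
apply: runs_leq (runs_impl _ (@runs_for _ Inv 1 nvar n _ (60 * n + 50) _ _ _ h0)).
- rewrite /=; nia.
- by move=> s [? ? ? h]; split=> // j jn; apply: h.
- by move=> k s [].
move=> j s jn [e0 e1 hr hs].
pose cnt i := count (fun i => (rel i < rel j)%R) (iota 0 i).
have cntS i : cnt i.+1 = cnt i + (rel i < rel j)%R.
  by rewrite /cnt -addn1 iotaD count_cat /= addn0.
pose J i t := [/\ imem t 0 = n /\ imem t 1 = j, imem t 2 = i,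
   imem t 3 = cnt i,
   rmem t = rmem s & forall a, 10 <= a -> imem t a = imem s a].
have body : runs (For 2 nvar (If (RLe (RLoad (ivar 1)) (RLoad (ivar 2))) Skip (incr 3)))
  (istore s 3 0) (((30 + 2 + 5) * n + 2 + 10)) (J n).
  apply: (@runs_for _ J) => //.
  - by move=> k t [[]].
  - move=> i t li [[t0 t1] t2 t3 tr ta].
    apply: runs_leq (runs_wp _) => //=.
    rewrite t1 t2 tr !hr ?ltn_addr //.
    case: lerP => h; mem_simp; split; mem_simp;
    rewrite ?t1 ?t2 ?t3 ?cntS ?ltNge ?h ?addn1 ?addn0 //;
    try by rewrite leNgt h addn1.
    1,2: by move=> a a10; mem_simp; apply: ta.
  - split; mem_simp => // a a10; mem_simp; done.
apply: (@runs_leq _ _ _ ((3 + (((30 + 2 + 5) * n + 2 + 10) + 20)) + 6)); first lia.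
apply: (@runs_seq _ _ _ _ _ _ (fun t => Inv j.+1 (istore t 1 j.+1) /\ imem t 1 = j)).
  apply: runs_seq (_ : runs _ _ _ (eq^~ (istore s 3 0))) _; first exact: runs_wp.
  move=> _ ->; apply: runs_seq body _ => t [[t0 t1] t2 t3 tr ta].
  apply: runs_leq (runs_wp _) => //=.
  have rj := rank_lt_n rel jn; rewrite /cnt -/(rank n rel j) in t3.
  split; mem_simp; rewrite ?t0 ?t1 ?t3 ?tr //; split; mem_simp => //.
  - by move=> a an; mem_simp; rewrite tr; apply: hr.
  - move=> k kj kn; mem_simp.
    have [kj'|->] : k < j \/ k = j by lia.
      have [h1 h2] := hs k kj' kn; mem_simp.
      rewrite ta ?h1; last lia; split=> //.
      (* Distinct ranks protect the entries written earlier. *)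
      have : rank n rel k <> rank n rel j by move=> /(rank_inj rel_inj kn jn); lia.
      by move=> ne; mem_simp; rewrite tr.
    by mem_simp; split=> //; apply: hr; lia.
move=> t [It t1]; apply: runs_leq (runs_wp _) => //=.
by rewrite t1 addn1.
Qed.
Variables (rk : nat -> nat) (r : nat -> R).
Hypothesis r_incr : forall i j, (i < j < n)%N -> (r i < r j)%R.

Definition sorted_mem s := [/\ imem s 0 = n,
  forall j, j < n -> imem s (10 + j) = rk j
  & forall k, k < n -> rmem s (n + 10 + k) = r k].

(** Characterises the maximum [B i] without a big operator: iterating the two inequalities gives all
    upper bounds, and the last clause says that one is attained. *)
Definition tail_of (B : nat -> R) := forall i, i < n ->
  [/\ (1 - r i <= B i)%R, i.+1 < n -> (1 + B i.+1 <= B i)%R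
    & exists2 j, i <= j < n & B i = ((j - i)%N.+1%:R - r j)%R].

Lemma sorted_mem_frame s s' : sorted_mem s -> imem s' 0 = imem s 0 ->
  (forall a, 10 <= a -> imem s' a = imem s a) ->
  (forall a, n + 10 <= a < n + n + 10 -> rmem s' a = rmem s a) -> sorted_mem s'.
Proof.
move=> [e0 hk hr] e0' he hm; split; first by rewrite e0'.
  by move=> j jn; rewrite he ?hk //; lia.
by move=> k kn; rewrite hm ?hr //; lia.
Qed.

Lemma tail_spec s0 : sorted_mem s0 ->
  runs tail_cmd s0 (200 * n ^ 2) (fun s =>
   [/\ sorted_mem s, tail_of (fun k => rmem s (n + n + 10 + k))
     & forall a, a < n + 10 -> rmem s a = rmem s0 a]).
Proof.
move=> h0; have [e0 _ hr0] := h0.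
pose Inv k s := [/\ sorted_mem s, imem s 1 = k, forall a, a < n + 10 -> rmem s a = rmem s0 a,
    rmem s (n + n + 10 + n) = (- r n.-1)%R
  & let B k := rmem s (n + n + 10 + k) in
    forall i, n - k <= i < n ->
  [/\ (1 - r i <= B i)%R, i.+1 < n -> (1 + B i.+1 <= B i)%R
    & exists2 j, i <= j < n & B i = ((j - i)%N.+1%:R - r j)%R]].
apply: (@runs_leq _ _ _ (30 + ((100 + 2 + 5) * n + 2 + 10))); first by nia.
apply: runs_seq (_ : runs _ _ _ (Inv 0 \o (fun s => istore s 1 0))) _.
  apply: runs_leq (runs_wp _) => //=.
  rewrite e0 /= hr0; last lia.
  split; mem_simp => //.
  - by apply: sorted_mem_frame h0 _ _ _ => [|a ha|a ha]; mem_simp.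
  - by move=> a ha; mem_simp.
  - by rewrite sub0r subn1.
  - by move=> i; lia.
move=> s Is; apply: (runs_impl _ (@runs_for _ Inv _ _ n _ 100 _ _ _ Is)) => {s Is}.
- by move=> s [h _ fr _ hB]; split=> // i i_n; apply: hB; lia.
- by move=> k s [[? _ _] ? _ _ _].
move=> k s kn [hs e1 fr hn hB]; have [se0 sk sr] := hs.
apply: runs_leq (runs_wp _) => //=.
rewrite /upd /= !se0 !e1. rewrite !(sr (n - (k + 1))); last lia.
have eS : n - (k + 1) + 1 = n - k by lia.
have eS' : (n - (k + 1)).+1 = n - k by lia.
have hk : n - (k + 1) < n by lia.
rewrite eS; set b := rmem s (n + n + 10 + (n - k)).
(* For [k = 0], [b] is the sentinel and [1 + b] is the term of job [n.-1] alone; otherwise the job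
   attaining [b] also attains [1 + b]. *)
have hb : exists2 j, n - (k + 1) <= j < n & (1 + b = (j - (n - (k + 1)))%N.+1%:R - r j)%R \/
    (j = n - (k + 1) /\ (1 + b <= 1 - r j)%R).
  case: (posnP k) => k0.
    exists n.-1; first lia. right; split; first lia.
    by rewrite /b k0 subn0 hn; lra.
  have [_ _ [j ij hj]] := hB (n - k) ltac:(lia).
  exists j; first lia. left; rewrite /b hj.
  have -> : (j - (n - (k + 1))).+1 = (j - (n - k)).+2 by lia.
  rewrite -[in RHS]natr1; lra.
have key v : (1 - r (n - (k + 1)) <= v)%R -> (1 + b <= v)%R ->
   (exists2 j, n - (k + 1) <= j < n & v = ((j - (n - (k + 1)))%N.+1%:R - r j)%R) ->
   Inv k.+1 (istore (rstore (istore s 2 (n - (k + 1))) (n + n + 10 + (n - (k + 1))) v) 1 (k + 1)).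
  move=> v1 v2 v3; split; mem_simp; rewrite ?addn1 //.
  - by apply: sorted_mem_frame hs _ _ _ => [|a ha|a ha]; mem_simp.
  - by move=> a ha; mem_simp; apply: fr.
  - move=> i hi; have [ii|->] : n - k <= i \/ i = n - (k + 1) by lia.
      by have := hB i ltac:(lia); mem_simp.
    by mem_simp; rewrite eS'; split.
case: ifP => h; apply: key => //.
- case: hb => j hj [hb|[ej hb]]; exists j => //.
  by rewrite ej subnn; move: h hb; rewrite -ej => h hb; lra.
- by move/negbT: h; rewrite -ltNge => /ltW.
- by exists (n - (k + 1)); [lia|rewrite subnn].
Qed.

(** * The dynamic program over the number of batches *)

Variable B : nat -> R.
Hypothesis B_tail : tail_of B.
Variable K : R.

Let B_ge i : i < n -> (1 - r i <= B i)%R. Proof. by move=> /B_tail[]. Qed.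
Let B_step i : i.+1 < n -> (1 + B i.+1 <= B i)%R.
Proof. by move=> h; have [_ /(_ h)] := B_tail (ltnW h). Qed.

Definition core s := sorted_mem s /\ forall k, k < n -> rmem s (n + n + 10 + k) = B k.

Lemma core_frame s s' : core s -> imem s' 0 = imem s 0 ->
  (forall a, 10 <= a -> imem s' a = imem s a) ->
  (forall a, n + 10 <= a < n + n + n + 11 -> rmem s' a = rmem s a) -> core s'.
Proof.
move=> [hs hB] e0 he hm; split.
  by apply: sorted_mem_frame hs e0 he _ => a ha; apply: hm; lia.
by move=> k kn; rewrite hm ?hB //; lia.
Qed.

(** Each entry is determined by the bounds that it satisfies. The empty prefix is covered for every
    [F], so [D 0 = 0] is a stand-in for minus infinity, whence the restriction to nonnegative
    [F]. *)
Definition dp_table q (D : nat -> R) : Prop :=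
  [/\ D 0 = 0%R, forall k, k <= n -> (0 <= D k)%R
    & forall k, k <= n -> forall F, (0 <= F)%R ->
        (D k <= F)%R <-> cov r B F q k].

Definition dp_inv q s : Prop :=
  [/\ core s, rmem s (n + 2) = K, rmem s (n + 3) = (K *+ q)%R
   & dp_table q (fun k => rmem s (n + n + n + 11 + k)) /\
   [/\ (0 <= rmem s (n + 5))%R,
      exists2 qs, cov r B (rmem s (n + 5)) qs n &
          rmem s (n + 4) = (rmem s (n + 5) + K *+ qs)%R
     & forall q' F, 0 < q' <= q -> (0 <= F)%R -> cov r B F q' n ->
        (rmem s (n + 4) <= F + K *+ q')%R]].

Lemma dp_init_spec s0 : core s0 -> (rmem s0 n + rmem s0 (n + 1) = K)%R ->
  runs dp_init_cmd s0 (200 * n ^ 2) (dp_inv 1).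
Proof.
move=> c0 hK; have [[e0 _ hr] hB] := c0.
pose Inv k s := [/\ core s, imem s 1 = k, forall a, a < n + 10 -> rmem s a = rmem s0 a
   & forall i, i < k -> i < n -> rmem s (n + n + n + 11 + (i + 1)) = (r i + B 0)%R].
apply: (@runs_leq _ _ _ (((60 + 2 + 5) * n + 2 + 10) + 120)); first by nia.
apply: runs_seq (_ : runs _ _ _ (Inv n)) _.
  apply: runs_for.
  - by move=> k s [[[? _ _] _] ? _ _].
  - move=> k s kn [cs e1 fr hD]; have [[se0 _ sr] sB] := cs.
    apply: runs_leq (runs_wp _) => //=.
    rewrite /upd /= !se0 !e1 sr // sB //; split; mem_simp; rewrite ?e1 ?addn1 //.
    + by apply: core_frame cs _ _ _ => [|a ha|a ha]; mem_simp.
    + by move=> a ha; mem_simp; apply: fr.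
    + move=> i ik i_n; have [ii|->] : i < k \/ i = k by lia.
        by mem_simp; apply: hD.
      by mem_simp.
  - split; mem_simp => //.
move=> s [cs e1 fr hD]; have [[se0 _ sr] sB] := cs.
apply: runs_leq (runs_wp _) => //=.
have n1 : n = (n.-1 + 1) by lia.
have hDn : rmem s (n + n + n + 11 + n) = (r n.-1 + B 0)%R.
  by rewrite [in X in _ + X]n1 hD //; lia.
have hD0 : (0 <= r n.-1 + B 0)%R.
  have := B_ge n_gt0; have : (r 0 <= r n.-1)%R by apply: (r_mono r_incr); lia.
  by move=> ? ?; lra.
rewrite se0; mem_simp; rewrite addn0.
rewrite (fr (n + 0)) ?(fr (n + 1)) ?addn0 ?hK ?hDn; try lia.
split; mem_simp => //.
  by apply: core_frame cs _ _ _ => [|a ha|a ha]; mem_simp.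
split; split; mem_simp => //.
- move=> k kn; mem_simp; case: eqP => // hk.
  have -> : k = k.-1 + 1 by lia.
  rewrite hD; try lia.
  have := B_ge n_gt0; have : (r 0 <= r k.-1)%R by apply: (r_mono r_incr); lia.
  by move=> ? ?; lra.
- move=> k kn F F0; mem_simp; case: eqP => hk.
    have -> : k = 0 by lia.
    by split=> // _; left.
  have e : k = k.-1 + 1 by lia.
  by rewrite cov1; [rewrite [in rmem _ _]e hD //; lia|lia].
- by exists 1 => //; apply/cov1.
- move=> q' F hq' F0; have -> : q' = 1 by lia.
  by move/cov1 => h; rewrite lerD2r; apply: h.
Qed.

(** Each step lowers one of [e] and [p] and leaves the other alone, so [e + p], less than [2n] at
    the start, is a variant and the layer takes linear time. *)
Lemma dp_layer_spec q s0 : core s0 ->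
  dp_table q (fun k => rmem s0 (n + n + n + 11 + k)) ->
  runs dp_layer_cmd s0 (400 * n + 50) (fun s =>
    [/\ core s, imem s 1 = imem s0 1,
       forall a, a < n + n + n + 11 -> rmem s a = rmem s0 a
      & dp_table q.+1 (fun k => rmem s (n + n + n + 11 + k))]).
Proof.
move=> c0; set D := (fun k => _) => -[D0 Dge0 HD]; have [[e0 _ _] _] := c0.
pose Inv s := [/\ core s, imem s 1 = imem s0 1,
       forall a, a < n + n + n + 11 -> rmem s a = rmem s0 a
      & let e := imem s 3 in let p := imem s 4 in
       [/\ e <= n /\ p < n, forall k, k <= e -> rmem s (n + n + n + 11 + k) = D k,
         forall i, p < i < e -> (r e.-1 + B i < D i)%R
        & forall k, e < k <= n -> (0 <= rmem s (n + n + n + 11 + k))%R /\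
          (forall F, (0 <= F)%R -> (rmem s (n + n + n + 11 + k) <= F)%R <-> cov r B F q.+1 k)]].
apply: (@runs_leq _ _ _ (20 + ((4 + 190) * (n + n) + 4))); first by lia.
apply: runs_seq (_ : runs _ _ _ (fun s => Inv s /\ imem s 3 + imem s 4 <= n + n)) _.
  apply: runs_leq (runs_wp _) => //=.
  rewrite /upd /= e0 /=; split; last by mem_simp; lia.
  split; mem_simp => //.
  by split=> [|k hk|i hi|k hk] //; lia.
move=> s1 [I1 mu1].
apply: (runs_leq _ (runs_impl _ (@runs_while _ Inv
  (fun s => imem s 3 + imem s 4) (ILe (IConst 1) (ivar 3)) dp_step_cmd 190 s1 _ I1))).
- by rewrite leq_add2r leq_mul2l.
- move=> s [[cs h1 fr [[en pn] hD _ hN]]] /= he; split=> //.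
  have {}he : imem s 3 = 0 by lia.
  split; first by rewrite hD.
    move=> k kn; have [->|k0] : k = 0 \/ 0 < k by lia.
      by rewrite hD // D0.
    by case: (hN k) => //; lia.
  move=> k kn F F0; have [->|k0] : k = 0 \/ 0 < k by lia.
    by rewrite hD // D0; split=> // _; exact: cov0.
  by case: (hN k) => [|_]; [lia|apply].
move=> {s1 I1 mu1} s [cs h1 fr [[]]].
set e := imem s 3; set p := imem s 4 => en pn hD hp hN /= he.
rewrite -/e in he.
have [[se0 _ sr] sB] := cs.
apply: runs_leq (runs_wp _) => //=.
rewrite /upd /= !se0 -!/e -!/p.
case: (leqP e p) => ep.
  split; last by mem_simp; lia.
  split; mem_simp => //.
  by rewrite -/e -/p; split=> // [|i hi]; [lia|apply: hp; lia].
rewrite subn1 addn1 !sr ?sB ?(hD p) ?(hD p.+1); try lia.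
case: lerP => hDp; last first.
  (* At [p = 0] the test cannot fail, since [D 0 = 0] is below every batch cost; so decrementing [p]
     is a genuine decrease. *)
  have p0 : 0 < p.
    rewrite lt0n; apply/eqP=> p0; move: hDp; rewrite p0 D0.
    have := B_ge n_gt0; have : (r 0 <= r e.-1)%R by apply: (r_mono r_incr); lia.
    by move=> ? ? ?; lra.
  split; last by mem_simp; lia.
  split; mem_simp => //.
  rewrite -/e; split=> // [|i hi]; first lia.
  have [->//|hi'] : i = p \/ p < i by lia.
  by apply: hp; lia.
have key v : v = Num.min (r e.-1 + B p)%R (D p.+1) ->
  let s' := istore (rstore s (n + n + n + 11 + e) v) 3 e.-1 in
  Inv s' /\ imem s' 3 + imem s' 4 < e + p.
  move=> ev; split; last by mem_simp; rewrite -/p; lia.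
  split; mem_simp => //.
  - by apply: core_frame cs _ _ _ => [|a ha|a ha]; mem_simp.
  - by move=> a ha; mem_simp; apply: fr.
  rewrite -/p; split; first lia.
  - by move=> k hk; mem_simp; apply: hD; lia.
  (* Lowering [e] lowers [r e.-1], so candidates beyond [p] stay beyond the crossing point. *)
  - move=> i hi; apply: le_lt_trans (hp i _); last lia.
    by rewrite lerD2r; apply: (r_mono r_incr); lia.
  move=> k hk; have [->|hk'] : k = e \/ e < k by lia.
    mem_simp; rewrite ev; split.
      rewrite le_min Dge0; last lia.
      rewrite andbT; have := @B_ge p pn; have : (r p <= r e.-1)%R by apply: (r_mono r_incr); lia.
      by move=> ? ?; lra.
    move=> F F0; have {2}-> : e = e.-1.+1 by lia.
    apply: (cov_layer r_incr B_step HD) => //; first lia.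
    by move=> i hi; apply: hp; lia.
  by mem_simp; apply: hN; lia.
by case: lerP => hv; apply: key; [rewrite min_l|rewrite min_r ?ltW].
Qed.

(** Layer 1 is already in place, so [n] rounds of linear cost reach layer [n.+1]. *)
Lemma dp_spec s0 : dp_inv 1 s0 -> runs dp_cmd s0 (1000 * n ^ 2) (dp_inv n.+1).
Proof.
move=> h0; pose Inv k s := imem s 1 = k /\ dp_inv k.+1 s.
have I0 : Inv 0 (istore s0 1 0) by [].
apply: runs_leq (runs_impl _ (@runs_for _ Inv 1 nvar n _ (400 * n + 50 + 200 + 6) _ _ _ I0)).
- rewrite /=; nia.
- by move=> s [].
- by move=> k s [? [[[? _ _] _] _ _ _]].
move=> k s kn [e1 [cs hK hC [hD [F0 [qs cq hb] hmin]]]].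
apply: (@runs_seq _ _ _ _ _ _ (fun t => imem t 1 = k /\ dp_inv k.+2 t)); last first.
  by move=> t [t1 ht]; apply: runs_leq (runs_wp _) => //=; rewrite t1 addn1; split.
apply: runs_seq (dp_layer_spec cs hD) _ => t [ct t1 fr hD'].
have [[te0 _ _] _] := ct; have [D0' Dge0' HD'] := hD'.
apply: runs_leq (runs_wp _) => //=.
rewrite /upd /= !te0; mem_simp.
rewrite (fr (n + 2)) ?(fr (n + 3)) ?(fr (n + 4)) ?hK ?hC; try lia.
have eK : (K *+ k.+1 + K = K *+ k.+2)%R by rewrite [RHS]mulrSr.
set Dn := rmem t (n + n + n + 11 + n).
have Dn0 : (0 <= Dn)%R by exact: Dge0'.
have cDn : cov r B Dn k.+2 n by apply/HD'.
case: lerP => hle.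
  split; first by mem_simp; rewrite t1.
  split; mem_simp; rewrite ?fr //; try lia.
  - by apply: core_frame ct _ _ _ => [|a ha|a ha]; mem_simp.
  - split.
      split; mem_simp => //.
        by move=> i i_n; mem_simp; apply: Dge0'.
      by move=> i i_n F F_0; mem_simp; apply: HD'.
    split; mem_simp; rewrite ?fr //; try lia; first by exists qs.
    move=> q' F hq' F_0 cF; have [hq|eq] : q' <= k.+1 \/ q' = k.+2 by lia.
      by apply: hmin => //; lia.
    apply: le_trans hle _; rewrite eq eK lerD2r.
    by apply/HD' => //; rewrite -eq.
split; first by mem_simp; rewrite t1.
split; mem_simp; rewrite ?fr //; try lia.
- by apply: core_frame ct _ _ _ => [|a ha|a ha]; mem_simp.
- split.
    split; mem_simp => //.
      by move=> i i_n; mem_simp; apply: Dge0'.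
    by move=> i i_n F F_0; mem_simp; apply: HD'.
  split; mem_simp => //; first by exists k.+2; rewrite ?eK.
  move=> q' F hq' F_0 cF; have [hq|eq] : q' <= k.+1 \/ q' = k.+2 by lia.
    by apply: le_trans (ltW hle) _; apply: hmin => //; lia.
  rewrite eq eK lerD2r; by apply/HD' => //; rewrite -eq.
Qed.

(** * Recovering a schedule from the best flow bound *)

Section Schedule.

Variables (F : R) (qs : nat).
Hypothesis cov_F : cov r B F qs n.

(** The bound uses [B j] in place of [1 - r j]: it is stronger, and it survives the delays that
    later jobs suffer. *)
Definition served (vl : seq R) s j : Prop :=
  let T := rmem s (n + n + n + n + 12 + j) in
  (exists2 u, u \in vl & (r j <= u <= T)%R) /\ (T + B j <= F)%R.

Definition repl_mem (vl : seq R) s : Prop :=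
  [/\ imem s 5 = size vl, size vl <= n
    & forall i, i < size vl ->
        rmem s (n + n + n + n + n + 20 + (n - size vl + i)) = nth 0%R vl i].

Definition scheduled (vl : seq R) s : Prop :=
  [/\ core s, sorted <%R vl, size vl <= qs, repl_mem vl s
    & forall j, j < n -> served vl s j].

(** From the right, a replenishment is kept as long as the bound [F] permits. A greedy batch reaches
    at least as far left as the last batch of any cover, so what remains is covered by one batch
    fewer, and at most [qs] batches are opened. *)
Lemma greedy_spec s0 : core s0 -> rmem s0 (n + 5) = F ->
  runs greedy_cmd s0 (400 * n ^ 2) (fun s => exists vl, scheduled vl s).
Proof.
move=> c0 eF; have [[e0 _ sr0] sB0] := c0.
have diag i : i < n -> (r i + B i <= F)%R.
  by move=> i_n; apply: (cov_le r_incr B_step i_n _ cov_F).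
pose Inv k s := [/\ core s, imem s 1 = k, rmem s (n + 5) = F
  & exists vl e q,
    [/\ [/\ sorted <%R (r e.-1 :: vl), size vl <= k & repl_mem (r e.-1 :: vl) s],
        rmem s (n + 6) = r e.-1 /\ n - 1 - k < e <= n,
        size vl + q.+1 = qs /\ cov r B F q.+1 e, (r e.-1 + B (n - 1 - k)%N <= F)%R
      & forall j, n - 1 - k <= j < n -> served (r e.-1 :: vl) s j]].
apply: (@runs_leq _ _ _ (100 + ((200 + 4 + 5) * (n - 1) + 4 + 10))); first by nia.
apply: runs_seq (_ : runs _ _ _ (Inv 0 \o (fun s => istore s 1 0))) _.
  apply: runs_leq (runs_wp _) => //=.
  rewrite /upd /= !e0 !sr0; try lia.
  mem_simp; split; mem_simp => //.
  - by apply: core_frame c0 _ _ _ => [|a ha|a ha]; mem_simp.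
  case: qs cov_F => [|q cq]; first by case=> //; lia.
  exists [::], n, q; rewrite subn1; split=> //.
  - split=> //; split; mem_simp => // i hi; have -> : i = 0 by lia.
    by mem_simp.
  - by mem_simp; split=> //; lia.
  - by rewrite subn0; apply: diag; lia.
  - move=> j hj; have -> : j = n.-1 by lia.
    split; mem_simp; last by apply: diag; lia.
    by exists (r n.-1); rewrite ?mem_head ?lexx.
move=> s Is; apply: (runs_impl _ (@runs_for _ Inv _ _ (n - 1) _ 200 _ _ _ Is)) => {s Is}.
- move=> s [cs e1 _ [vl [e [q [[so sz rm] _ [eq cq] _ sv]]]]].
  exists (r e.-1 :: vl); split=> //; first by rewrite /=; lia.
  by move=> j jn; apply: sv; lia.
- by move=> k s [[[es _ _] _] e1 _ _]; rewrite /= es.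
move=> k s kn [cs e1 hF [vl [e [q [[so sz rm] [hu he] [eq cq] hlo sv]]]]].
have [[se0 _ sr] sB] := cs; have [r5 rn rmm] := rm.
apply: runs_leq (runs_wp _) => //=.
rewrite /upd /= !se0 !e1 !r5.
have ej : n - 1 - k.+1 = n - (k + 2) by lia.
have ej' : n - 1 - k = (n - (k + 2)).+1 by lia.
have jn : n - (k + 2) < n by lia.
move: ej ej' jn; set j := n - (k + 2) => ej ej' jn.
rewrite sB ?sr // hu hF /= in rmm *.
rewrite ej' in hlo sv he.
case: lerP => hle; mem_simp; rewrite ?hu.
  split; mem_simp; rewrite ?e1 ?addn1 //.
  - by apply: core_frame cs _ _ _ => [|a ha|a ha]; mem_simp.
  exists vl, e, q; rewrite ej; split=> //.
  - split=> //; first lia.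
    by split; mem_simp => // i hi; mem_simp; apply: rmm.
  - by mem_simp; split=> //; lia.
  - move=> i hi; have [->|hi'] : i = j \/ j < i by lia.
      split; mem_simp => //; exists (r e.-1); rewrite ?mem_head ?lexx ?andbT //.
      by apply: (r_mono r_incr); lia.
    by have := sv i ltac:(lia); rewrite /served; mem_simp.
(* The last batch of the cover opens at [i0]; job [j] failed the test that [i0] passes, so [j < i0]
   and the prefix up to [j] needs only [q] batches. *)
have [i0 [i0e ci0 hi0]] : exists i, [/\ i < e, cov r B F q i & (r e.-1 + B i <= F)%R].
  by case: cq => // e_0; lia.
have ji0 : j < i0.
  rewrite ltnNge; apply/negP => i0j; move: hle; apply/negP; rewrite -leNgt.
  apply: le_trans hi0; rewrite lerD2l; apply: (B_anti B_step); lia.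
have {ci0 hi0} cj : cov r B F q j.+1 by apply: cov_prefix r_incr _ _ _ _ _ ci0; lia.
case: q eq cq cj => [|q] eq cq cj; first by case: cj.
split; mem_simp; rewrite ?e1 ?addn1 //.
- by apply: core_frame cs _ _ _ => [|a ha|a ha]; mem_simp.
exists (r e.-1 :: vl), j.+1, q; rewrite ej; split=> //.
- split=> //=.
    by rewrite /= in so; rewrite so andbT; apply: r_incr; lia.
  split; mem_simp; [by []|lia|].
  case=> [|i] hi; mem_simp; first by [].
  rewrite -rmm /=; last by move: hi => /=; lia.
  by mem_simp; congr (rmem s _); lia.
- by mem_simp; split=> //; lia.
- by split=> //=; lia.
- exact: diag.
- move=> i hi; have [->|hi'] : i = j \/ j < i by lia.
    by split; mem_simp; [exists (r j); rewrite ?mem_head ?lexx|exact: diag].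
  have [[u uv hu'] hT] := sv i ltac:(lia); split; mem_simp => //.
  by exists u; rewrite // inE uv orbT.
Qed.

(** Delaying job [k.+1] to [T k + 1] keeps its bound, because [1 + B k.+1 <= B k], and keeps it
    ready, because its start only moves later. *)
Lemma start_spec s0 vl : scheduled vl s0 ->
  runs start_cmd s0 (200 * n ^ 2) (fun s => scheduled vl s /\
    forall j, j.+1 < n -> (rmem s (n + n + n + n + 12 + j) + 1 <=
                           rmem s (n + n + n + n + 12 + j.+1))%R).
Proof.
move=> h0; pose Inv k s := [/\ imem s 1 = k, scheduled vl s &
  forall j, j < k -> j.+1 < n -> (rmem s (n + n + n + n + 12 + j) + 1 <=
                           rmem s (n + n + n + n + 12 + j.+1))%R].
have I0 : Inv 0 (istore s0 1 0) by [].
apply: (@runs_leq _ _ _ ((150 + 4 + 5) * (n - 1) + 4 + 10)); first by nia.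
apply: (runs_impl _ (@runs_for _ Inv _ _ (n - 1) _ 150 _ _ _ I0)).
- by move=> s [_ ? h]; split=> // j jn; apply: h; lia.
- by move=> k s [? [[[es _ _] _] _ _ _ _] _]; rewrite /= es.
move=> k s kn [e1 [cs so sz rm sv] hst]; have [[se0 _ sr] sB] := cs.
have [r5 rn rmm] := rm.
apply: runs_leq (runs_wp _) => //=.
rewrite /upd /= !se0 !e1 !addn1.
have [[u uvl /andP[ru uT]] hT] := sv k.+1 ltac:(lia).
have [_ hT'] := sv k ltac:(lia).
have hB : (1 + B k.+1 <= B k)%R by apply: B_step; lia.
case: lerP => hle; mem_simp.
  split; mem_simp => //.
    split=> //.
    - by apply: core_frame cs _ _ _ => [|a ha|a ha]; mem_simp.
    - by split; mem_simp => // i hi; mem_simp; apply: rmm.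
    move=> j jn; have [->|jk] : j = k.+1 \/ j <> k.+1 by lia.
      split; mem_simp; last by lra.
      by exists u; rewrite // ru (le_trans uT).
    by have := sv j jn; rewrite /served; mem_simp.
  move=> j jk jn; have [->|jk'] : j = k \/ j < k by lia.
    by mem_simp.
  by mem_simp; apply: hst.
split; mem_simp; rewrite ?e1 ?addn1 //.
move=> j jk jn; have [->|jk'] : j = k \/ j < k by lia.
  exact: ltW.
exact: hst.
Qed.

Lemma output_spec s0 vl : scheduled vl s0 -> (forall j, j < n -> rk j < n) ->
  runs output_cmd s0 (200 * n ^ 2) (fun s =>
   [/\ imem s 0 = size vl,
      forall j, j < n -> rmem s j = rmem s0 (n + n + n + n + 12 + rk j)
    & forall i, i < size vl -> rmem s (n + i) = nth 0%R vl i]).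
Proof.
move=> [[[e0 hk _] _] so sz [r5 rn rmm] sv] rkn.
pose Inv k s := [/\ imem s 0 = n, imem s 1 = k, forall a, 5 <= a -> imem s a = imem s0 a,
   forall a, n <= a -> rmem s a = rmem s0 a &
   forall j, j < k -> j < n -> rmem s j = rmem s0 (n + n + n + n + 12 + rk j)].
apply: (@runs_leq _ _ _ (((60 + 2 + 5) * n + 2 + 10) +
  (((60 + 2 + 5) * size vl + 2 + 10) + 10))); first by nia.
apply: runs_seq (_ : runs _ _ _ (Inv n)) _.
  apply: runs_for.
  - by move=> k s [? ? _ _ _].
  - move=> k s kn [se0 e1 fi fr hT].
    apply: runs_leq (runs_wp _) => //=.
    rewrite /upd /= !se0 !e1 fi // hk // fr; last lia.
    split; mem_simp; rewrite ?e1 ?addn1 //.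
    + by move=> a ha; mem_simp; apply: fi.
    + by move=> a ha; mem_simp; apply: fr.
    + move=> j jk jn; have [->|jk'] : j = k \/ j < k by lia.
        by mem_simp.
      by mem_simp; apply: hT.
  - by split; mem_simp => // a ha; mem_simp.
move=> s1 [se0 e1 fi fr hT].
pose J k s := [/\ imem s 0 = n /\ imem s 5 = size vl, imem s 1 = k,
   forall a, n + n <= a -> rmem s a = rmem s0 a,
   forall j, j < n -> rmem s j = rmem s0 (n + n + n + n + 12 + rk j)
  & forall i, i < k -> i < size vl -> rmem s (n + i) = nth 0%R vl i].
apply: runs_seq (_ : runs _ _ _ (J (size vl))) _.
  apply: (@runs_for _ J) => //.
  - by move=> k s [[? ?] ? _ _ _].
  - move=> k s kn [[t0 t5] t1 tr tS tV].
    apply: runs_leq (runs_wp _) => //=.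
    rewrite /upd /= !t0 !t5 !t1 tr; last lia.
    rewrite rmm //; split; mem_simp; rewrite ?addn1 //.
    + by move=> a ha; mem_simp; apply: tr.
    + by move=> j jn; mem_simp; apply: tS.
    + move=> i ik i_n; have [->|jk'] : i = k \/ i < k by lia.
        by mem_simp.
      by mem_simp; apply: tV.
  - split; mem_simp => //; first by split=> //; rewrite fi.
    + by move=> a ha; apply: fr; lia.
    + by move=> j jn; apply: hT.
move=> s [[t0 t5] t1 tr tS tV]; apply: runs_leq (runs_wp _) => //=.
split; mem_simp => // i hi; exact: tV.
Qed.

End Schedule.

End Phases.

(** * Optimality of the computed schedule *)

Section Correctness.

Local Open Scope ring_scope.

Variables (R : realDomainType) (I : instance R).
Hypothesis valid_I : valid_instance I.
Let n := njobs I.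
Let rel (a : nat) : R := rmem (input I) a.

Lemma rel_job (j : 'I_n) : rel j = release I j.
Proof. by rewrite /rel /= insubT //= => lt_j; congr release; apply: val_inj. Qed.

Lemma rel_cost0 : rel n = cost0 I.
Proof. by rewrite /rel /= insubF ?ltnn // eqxx. Qed.

Lemma rel_cost1 : rel n.+1 = cost1 I.
Proof. by rewrite /rel /= insubF ?eqxx ?(gtn_eqF (ltnSn _)) //; apply/negbTE; rewrite -leqNgt. Qed.

Lemma rel_inj i j : (i < n)%N -> (j < n)%N -> rel i = rel j -> i = j.
Proof.
move=> li lj; have [_ _ inj _ _] := valid_I.
by rewrite (rel_job (Ordinal li)) (rel_job (Ordinal lj)) => /inj[].
Qed.

Let rk (j : 'I_n) : 'I_n := Ordinal (rank_lt_n rel (ltn_ord j)).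

Lemma rk_inj : injective rk.
Proof. by move=> i j [] /(rank_inj rel_inj (ltn_ord i) (ltn_ord j)) /val_inj. Qed.

Lemma rank_surj k : (k < n)%N -> exists2 j, (j < n)%N & rank n rel j = k.
Proof.
move=> kn; have [g _ gK] := injF_bij rk_inj.
by exists (g (Ordinal kn)) => //; have /(congr1 val) := gK (Ordinal kn).
Qed.

Lemma sorted_release_incr (r : nat -> R) :
  (forall j, (j < n)%N -> r (rank n rel j) = rel j) ->
  forall i j, (i < j < n)%N -> r i < r j.
Proof.
move=> hr i j /andP[ij jn].
have [i' i'n ei] := rank_surj (ltn_trans ij jn).
have [j' j'n ej] := rank_surj jn.
rewrite -ei -ej !hr //; case: ltgtP => // h.
  by have := rank_lt j'n h; rewrite ei ej; lia.
by move: ij; rewrite -ei -ej (rel_inj i'n j'n h) ltnn.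
Qed.

(** Since [1 - r j <= B j], the schedule has maximum flow time at most [F]; any competitor yields a
    cover, to which the minimality of [F + K *+ qs] applies. *)
Lemma schedule_optimal (r B : nat -> R) (T : nat -> R) (vl : seq R)
    (F : R) (qs : nat) (x : solution R n) :
  let K := cost0 I + cost1 I in
  (forall j, (j < n)%N -> r (rank n rel j) = rel j) -> tail_of n r B ->
  0 <= F -> sorted <%R vl -> (size vl <= qs)%N ->
  (forall j, (j < n)%N ->
     (exists2 u, u \in vl & r j <= u <= T j) /\ T j + B j <= F) ->
  (forall j, (j.+1 < n)%N -> T j + 1 <= T j.+1) ->
  (forall q F', (0 < q <= n.+1)%N -> 0 <= F' -> cov r B F' q n ->
     F + K *+ qs <= F' + K *+ q) ->
  (forall j, start x j = T (rank n rel j)) -> repl x = vl ->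
  optimal I x.
Proof.
move=> K hr hB F0 so sz sv st best hS hV.
have [n0 _ _ K0 K1] := valid_I.
have r_incr := sorted_release_incr hr.
have r_rk j : r (rk j) = release I j by rewrite hr ?rel_job.
have K_ge0 : 0 <= K by rewrite addr_ge0.
have chain i j : (i < j < n)%N -> T i + 1 <= T j.
  case/andP; elim: j => // j IH ij jn; have := st j jn.
  have [lt_ij|->//] : (i < j)%N \/ i = j by lia.
  by have := IH lt_ij (ltnW jn); lra.
split; first split.
- by rewrite hV.
- move=> i j neq; rewrite /completion !hS.
  have : rk i != rk j by rewrite (inj_eq rk_inj).
  rewrite -(inj_eq val_inj) /= neq_ltn => /orP[h|h]; [left|right];
    apply: chain; rewrite h; exact: (valP (rk _)).
- move=> j; have [[u uv hu] _] := sv (rk j) (ltn_ord _).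
  by exists u; rewrite ?hV // hS -r_rk.
move=> y fy.
(* Capping the competitor at [n] replenishments brings it into the range of the table; by [cov_size]
   it still has a cover, and as [K >= 0] its cost only drops. *)
have /best : (0 < minn (size (repl y)) n <= n.+1)%N.
  have [_ _ /(_ (Ordinal n0))[u uy _]] := fy.
  by case: (repl y) uy => //= *; lia.
move/(_ (max_flow I y) (max_flow_ge0 y)) => h.
have /h{}h : cov r B (max_flow I y) (minn (size (repl y)) n) n.
  have c : cov r B (max_flow I y) (size (repl y)) n.
    by apply: (feasible_cov rk_inj r_rk r_incr) => // i /hB[].
  by rewrite /minn; case: ifP => // _; apply: cov_size c.
apply: le_trans (le_trans h _); last first.
  by rewrite /objective lerD2l ler_wpMn2l // geq_minl.
rewrite /objective hV lerD //; last by rewrite ler_wpMn2l.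
apply: bigmax_le => // j _; rewrite /completion hS -r_rk.
have [_ ?] := sv (rk j) (ltn_ord _); have [? _ _] := hB (rk j) (ltn_ord _).
by rewrite /=; lra.
Qed.

End Correctness.

(** * Assembling the phases *)

Definition jrp_cmd : cmd :=
  Seq sort_cmd (Seq tail_cmd (Seq dp_init_cmd
    (Seq dp_cmd (Seq greedy_cmd (Seq start_cmd output_cmd))))).

Theorem theorem8 :
  exists (P : cmd) (c : nat),
    forall (R : realDomainType) (I : instance R), valid_instance I ->
      exists (t : nat) (s : state R),
        [/\ exec P (input I) t s,
            t <= c * njobs I ^ 2
          & optimal I (output (njobs I) s)].
Proof.
(* The constant adds up the phases: five of 200, the dynamic program with 1000, the greedy phase
   with 400. *)
exists jrp_cmd, 2400 => R I vI; have [n_gt0 _ _ _ _] := vI.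
set n := njobs I in n_gt0 *.
pose rel := rmem (input I); pose rk := rank n rel.
suff : runs jrp_cmd (input I)
   (200 * n ^ 2 + (200 * n ^ 2 + (200 * n ^ 2 + (1000 * n ^ 2 +
   (400 * n ^ 2 + (200 * n ^ 2 + 200 * n ^ 2))))))
   (fun s => optimal I (output n s)).
  case=> t [s [E le opt]]; exists t, s; split=> //.
  by apply: leq_trans le _; lia.
apply: runs_seq (sort_spec n_gt0 (rel_inj vI) _ _) _ => // s1 [e1 fr1 hs1].
(* The sorted dates, and below [B] and the flow bound, are read off the memory; each specification
   supplies the properties assumed by the next. *)
pose r k := rmem s1 (n + 10 + k).
have hr j : j < n -> r (rk j) = rel j by move=> /hs1[].
have r_incr := sorted_release_incr vI hr.
have sm1 : sorted_mem n rk r s1 by split=> // j /hs1[].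
apply: runs_seq (tail_spec n_gt0 sm1) _ => s2 [sm2 tail fr2].
set B := (fun k => _) in tail.
have c2 : core n rk r B s2 by split.
pose K := (cost0 I + cost1 I)%R.
apply: runs_seq (@dp_init_spec _ _ n_gt0 _ _ r_incr _ tail K _ c2 _) _.
  rewrite !fr2 ?fr1; try lia.
  by rewrite addn1 (rel_cost0 I) (rel_cost1 I).
move=> s3 h3.
apply: runs_seq (dp_spec n_gt0 r_incr tail h3) _ => s4.
move=> [c4 _ _ [_ [F0 [qs cq hb] best]]].
apply: runs_seq (greedy_spec n_gt0 r_incr tail cq c4 erefl) _ => s5 [vl h5].
apply: runs_seq (start_spec n_gt0 tail h5) _ => s6 [h6 st6].
have rkn j : j < n -> rk j < n by exact: rank_lt_n.
apply: runs_impl (output_spec n_gt0 h6 rkn) => s [e0 hS hV].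
have [_ so sz _ sv] := h6.
apply: (schedule_optimal vI hr tail F0 so sz sv st6) => //.
- by move=> q F' hq F'0 cF; rewrite -hb; apply: best.
- by move=> j; apply: hS.
- rewrite /= e0; apply: (@eq_from_nth _ 0%R); rewrite size_mkseq // => i hi.
  by rewrite nth_mkseq // hV.
Qed.
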